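(* Let $k\ge 1$ and let $M$ be a $k$-tape classically-controlled quantum Turing machine operating in time $f(n)$, where $n$ is the input size. Then there exists a $2$-tape classically-controlled quantum Turing machine $M'$ operating in time $O(f(n)^2)$ such that for every input $\ket\psi$, $M(\ket\psi)=M'(\ket\psi)$.
   Context: A $k$-tape classically-controlled quantum Turing machine (CQTM), $k>0$, is a quintuple $M=(K,\Sigma_C,\Sigma_Q,\mathcal A,\delta)$: $K$ is a finite set of classical states with initial state $s$; $\Sigma_Q$ is a finite alphabet containing a blank $\#$ whose symbols label an orthonormal basis $\{\ket\tau\}$ of the Hilbert space of each quantum cell; each of the $k$ infinite tapes consists of such cells and has its own head; $\mathcal A$ is a finite set of $k$-cell admissible transformations, i.e. families $\{M_c\}_c$ of linear operators on $(\mathbb C^{|\Sigma_Q|})^{\otimes k}$ with $\sum_c M_c^\dagger M_c=\mathrm{Id}$, containing for each tape the blank test $\{\ket\#\bra\#, I-\ket\#\bra\#\}$ (outcomes $\#,\overline\#$) on that tape's cell; $\Sigma_C$ is a finite alphabet containing all outcomes of transformations in $\mathcal A$; and $\delta:K\times\Sigma_C\to(K\cup\{\text{yes},\text{no},h\})\times\{\leftarrow,\rightarrow,-\}^k\times\mathcal A$ is total. If $\delta(q,\tau)=(p,(D_1,\dots,D_k),A)$ and the machine is in state $q$ with last outcome $\tau$, the heads move according to $D_1,\dots,D_k$, then $A=\{M_c\}$ is applied to the $k$ pointed cells: outcome $c$ occurs with probability $\bra\psi M_c^\dagger M_c\ket\psi$ and the global state becomes $M_c\ket\psi$ normalized; the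 new state is $p$ and last outcome $c$. Each transition is one time step. The input state (a superposition of basis strings over $\Sigma_Q\setminus\{\#\}$ of length $n$) is placed on tape 1 on adjacent cells, all other cells are $\ket\#$, head 1 points to the blank cell immediately left of the input, the initial state is $s$ and the initial last outcome is $\#$. Reaching yes/no gives output yes/no; reaching $h$ gives as output the state of tape 1 from its leftmost non-$\ket\#$ cell to its rightmost non-$\ket\#$ cell. *)

(* Defs.v *)
From HB Require Import structures.
From mathcomp Require Import all_boot all_order all_algebra.
From mathcomp Require Import boolp classical_sets reals complex.
Set Implicit Arguments. Unset Strict Implicit. Unset Printing Implicit Defensive.
Import Order.TTheory GRing.Theory Num.Theory.
Local Open Scope ring_scope.

(** * Classically-controlled quantum Turing machines (CQTM)

   Complex numbers: [R[i]] for an arbitrary model [R : realType] of the reals.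
   A machine of type [cqtm R k Q qb] has [k.+1] tapes (indexed by ['I_k.+1],
   tape 1 of the paper is [ord0]); [CQTM R k Q qb := cqtm R k.-1 Q qb] is the
   type of [k]-tape machines (for [k >= 1]).  [Q] is the quantum alphabet
   Sigma_Q and [qb] its blank [#].  *)

Inductive dir := DL | DR | DN.
Inductive target (K : Type) := TGo of K | TYes | TNo | THalt.
Arguments TYes {K}. Arguments TNo {K}. Arguments THalt {K}.

(* possible results of a (branch of a) run; [RRun] marks a branch that has
   not yet reached yes/no/h within the allotted number of steps *)
Inductive result (C : Type) (Q : Type) :=
  RYes | RNo | RHalt of (seq Q -> seq Q -> C) | RRun.
Arguments RYes {C Q}. Arguments RNo {C Q}. Arguments RRun {C Q}.

Fixpoint memT (T : Type) (x : T) (s : seq T) : Prop :=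
  if s is y :: s' then y = x \/ memT x s' else False.

(* inputs: superpositions  sum_j a_j |w_j>  of strings w_j over Q \ {#}
   (given as a finite formal sum), all of length n, normalized *)
Section Inputs.
Variable R : realType.
Variables (Q : finType) (qb : Q).
Definition input := seq (seq Q * R[i]).
Definition valid_input (n : nat) (psi : input) : Prop :=
  all (fun p => (size p.1 == n) && (qb \notin p.1)) psi /\
  \sum_(p <- psi) \sum_(p' <- psi) (if p.1 == p'.1 then (p.2)^* * p'.2 else 0) = 1.
End Inputs.

Section CQTM.
Variable R : realType.
Local Notation C := (R[i]).
Variables (k : nat) (Q : finType) (qb : Q).
Local Notation nt := k.+1.

(* basis states of the k pointed cells *)
Definition cells := {ffun 'I_nt -> Q}.
(* a linear operator on (C^|Q|)^{(x) k}, given by its matrix: [O w u = <w|O|u>] *)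
Definition op := cells -> cells -> C.
(* basis configurations of the tapes, heads, and (unnormalized) quantum states
   represented as finite formal sums  sum_j a_j |x_j>  *)
Definition tapes := 'I_nt -> int -> Q.
Definition heads := 'I_nt -> int.
Definition ket := seq (tapes * C).

(* a k-cell transformation {M_c}_c with outcomes in the classical alphabet SC
   (M_c = 0 for c not an outcome) is admissible iff sum_c M_c^dag M_c = Id *)
Definition admissible (SC : finType) (T : SC -> op) : Prop :=
  forall u v : cells,
    \sum_(c : SC) \sum_(w : cells) (T c w u)^* * T c w v = (u == v)%:R.

(* the blank test {|#><#|, I - |#><#|} on the cell of tape i, outcomes cb (#)
   and cnb (non-#) *)
Definition blank_test (SC : finType) (cb cnb : SC) (i : 'I_nt) : SC -> op :=
  fun c w u =>
    if c == cb then ((w == u) && (u i == qb))%:R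
    else if c == cnb then ((w == u) && (u i != qb))%:R else 0.

Record cqtm := Cqtm {
  cK : finType;
  cs : cK;
  cSC : finType;
  cb : cSC;
  cnb : cSC;
  cA : seq (cSC -> op);
  cdelta : cK -> cSC -> target cK * ('I_nt -> dir) * (cSC -> op)
}.

Definition wf (M : cqtm) : Prop :=
  [/\ cb M != cnb M,
      (forall T, memT T (cA M) -> admissible T),
      (forall i, memT (blank_test (cb M) (cnb M) i) (cA M)) &
      (forall q c, memT (cdelta q c).2 (cA M))].

Definition move (h : heads) (D : 'I_nt -> dir) : heads := fun i =>
  match D i with DL => h i - 1 | DR => h i + 1 | DN => h i end.
Definition read (x : tapes) (h : heads) : cells := [ffun i => x i (h i)].
Definition write (x : tapes) (h : heads) (w : cells) : tapes :=
  fun i z => if z == h i then w i else x i z.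
Definition apply_op (O : op) (h : heads) (phi : ket) : ket :=
  flatten [seq [seq (write p.1 h w, O w (read p.1 h) * p.2) | w <- enum cells]
          | p <- phi].

Definition nrm (phi : ket) : C :=
  \sum_(p <- phi) \sum_(p' <- phi) if `[< p.1 = p'.1 >] then (p.2)^* * p'.2 else 0.

Definition amp (phi : ket) (x : tapes) : C :=
  \sum_(p <- phi) if `[< p.1 = x >] then p.2 else 0.

(* cell z of tape 1 is not in state |#>: some basis configuration in the
   support of phi has a non-blank symbol there *)
Definition occupied (phi : ket) (z : int) : Prop :=
  exists x : tapes, amp phi x != 0 /\ x ord0 z != qb.

Definition seg_bounds (phi : ket) : option (int * int) :=
  if `[< exists z, occupied phi z >] then
    Some (xget 0 (fun l => occupied phi l /\ forall z, occupied phi z -> l <= z),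
          xget 0 (fun r => occupied phi r /\ forall z, occupied phi z -> z <= r))
  else None.

Definition in_seg (b : option (int * int)) (z : int) : bool :=
  if b is Some (l, r) then (l <= z) && (z <= r) else false.

Definition seg (b : option (int * int)) (x : tapes) : seq Q :=
  if b is Some (l, r) then [seq x ord0 (l + j%:Z) | j <- iota 0 `|r - l|.+1]
  else [::].

Definition agree_off (b : option (int * int)) (x y : tapes) : bool :=
  `[< forall i z, ~ (i = ord0 /\ in_seg b z) -> x i z = y i z >].

(* output state of a halted branch: the (normalized) reduced density operator
   of tape 1 from its leftmost to its rightmost non-|#> cell, as a matrix
   indexed by strings over Q *)
Definition rho (phi : ket) : seq Q -> seq Q -> C := fun s t =>
  let b := seg_bounds phi in
  (\sum_(p <- phi) \sum_(p' <- phi)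
     if [&& seg b p.1 == s, seg b p'.1 == t & agree_off b p.1 p'.1]
     then p.2 * (p'.2)^* else 0) / nrm phi.

(* all branches of the computation for at most t steps, each with its
   probability (squared norm of the unnormalized branch state) and result *)
Fixpoint exec (M : cqtm) (t : nat) (q : cK M) (tau : cSC M) (h : heads)
    (phi : ket) {struct t} : seq (C * result C Q) :=
  if t is t'.+1 then
    let: (p, D, T) := cdelta q tau in
    let h' := move h D in
    flatten [seq let phic := apply_op (T c) h' phi in
                 match p with
                 | TGo q' => exec t' q' c h' phic
                 | TYes => [:: (nrm phic, RYes)]
                 | TNo => [:: (nrm phic, RNo)]
                 | THalt => [:: (nrm phic, RHalt (rho phic))]
                 end
            | c <- enum (cSC M)]
  else [:: (nrm phi, RRun)].

Definition init_tapes (w : seq Q) : tapes := fun i z =>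
  if (i == ord0) && ((1 <= z) && (z <= (size w)%:Z))
  then nth qb w `|z - 1|%N else qb.

Definition input_ket (psi : input R Q) : ket :=
  [seq (init_tapes p.1, p.2) | p <- psi].

(* initial configuration: state s, last outcome #, head 1 on the blank cell
   immediately left of the input (the input occupies cells 1..n of tape 1) *)
Definition run (M : cqtm) (t : nat) (psi : input R Q) : seq (C * result C Q) :=
  exec t (cs M) (cb M) (fun _ => 0) (input_ket psi).

Definition prob (M : cqtm) (t : nat) (psi : input R Q) (r : result C Q) : C :=
  \sum_(b <- run M t psi) if `[< b.2 = r >] then b.1 else 0.

(* M operates in time f(n): on every input of size n, every branch of
   nonzero probability has reached yes/no/h within f(n) steps *)
Definition time_bound (M : cqtm) (f : nat -> nat) : Prop :=
  forall n psi, valid_input qb n psi -> prob M (f n) psi RRun = 0.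

End CQTM.

Notation CQTM R k Q := (@cqtm R k.-1 Q).

Section Transport.
Variables (R : realType) (Q Q' : finType) (iota : Q -> Q').
Local Notation C := (R[i]).

Definition preim (s' : seq Q') : option (seq Q) :=
  foldr (fun q' acc => match [pick q | iota q == q'], acc with
                       | Some q, Some s => Some (q :: s)
                       | _, _ => None end) (Some [::]) s'.

Definition map_result (r : result C Q) : result C Q' :=
  match r with
  | RYes => RYes | RNo => RNo | RRun => RRun
  | RHalt rh => RHalt (fun s' t' => match preim s', preim t' with
                                   | Some s, Some t => rh s t
                                   | _, _ => 0 end)
  end.

Definition map_input (psi : input R Q) : input R Q' :=
  [seq (map iota p.1, p.2) | p <- psi].

(* M(|psi>) = M'(|psi>): the output distributions coincide (once both
   machines have finished, i.e. for all sufficiently large step counts) *)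
Definition same_output (k k' : nat) (qb : Q) (qb' : Q')
    (M : @cqtm R k Q) (M' : @cqtm R k' Q') (psi : input R Q) : Prop :=
  exists T, forall t, (T <= t)%N -> forall r' : result C Q',
    prob qb' M' t (map_input psi) r' =
    \sum_(b <- run qb M t psi) if `[< map_result b.2 = r' >] then b.1 else 0.

End Transport.

(* Main.v *)
(** Tape 1 of the simulating machine is tape 1 of the simulated one; its tape 2
   stores the other tapes folded and shifted so that all their heads sit on one
   cell, where the current transformation can be applied directly. A head move
   becomes a shift of the corresponding folded tape, i.e. a cyclic rotation of the
   visited region: one sweep outwards and one sweep back, each step swapping a
   symbol with spare room in the tape 1 cell under the head (the classical control
   cannot hold quantum symbols). The visited region grows by one cell per simulated
   step, so that t steps cost O(t^2). All moves and marks are classical, hence each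
   sweep is one deterministic branch, and the environment traced out in the output
   is merely relabelled injectively. *)

Require Import Defs.
From HB Require Import structures.
From mathcomp Require Import all_boot all_order all_algebra.
From mathcomp Require Import boolp classical_sets reals complex.
From mathcomp Require Import zify.
Import Order.TTheory GRing.Theory Num.Theory.
Local Open Scope ring_scope.
Set Implicit Arguments. Unset Strict Implicit. Unset Printing Implicit Defensive.

(** * Kets as linear functionals *)

Section Kets.
Variables (R : realType) (k : nat) (Q : finType).
Local Notation C := (R[i]).
Local Notation tapes := (tapes k Q).
Local Notation ket := (ket R k Q).

(* Kets are compared through the functionals they induce: amplitudes of equal
   basis states are then added up, and zero amplitudes ignored. *)
Definition lin (phi : ket) (G : tapes -> C) : C := \sum_(p <- phi) p.2 * G p.1.

Definition null (phi : ket) : Prop := forall G, lin phi G = 0.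

Definition supported (S : tapes -> Prop) (phi : ket) : Prop :=
  forall G G', (forall x, S x -> G x = G' x) -> lin phi G = lin phi G'.

Lemma eq_lin phi G G' : G =1 G' -> lin phi G = lin phi G'.
Proof. by move=> e; apply: eq_bigr => p _; rewrite e. Qed.

Lemma lin_apply_op (O : op R k Q) h phi G :
  lin (apply_op O h phi) G =
  lin phi (fun x => \sum_w O w (read x h) * G (write x h w)).
Proof.
rewrite /lin /apply_op big_flatten big_map; apply: eq_bigr => p _.
rewrite big_map big_enum mulr_sumr; apply: eq_bigr => w _ /=.
by rewrite [O _ _ * p.2]mulrC mulrA.
Qed.

Lemma apply_op_null O h phi : null phi -> null (apply_op O h phi).
Proof. by move=> n0 G; rewrite lin_apply_op n0. Qed.

Lemma apply_op_supported (S S' : tapes -> Prop) (O : op R k Q) h phi :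
  (forall x w, S x -> S' (write x h w)) ->
  supported S phi -> supported S' (apply_op O h phi).
Proof.
move=> SS' Sphi G G' eGG'; rewrite !lin_apply_op.
by apply: Sphi => x Sx; apply: eq_bigr => w _; rewrite eGG' //; apply: SS'.
Qed.

Lemma ampE phi x : amp phi x = lin phi (fun y => (`[< y = x >])%:R).
Proof. by apply: eq_bigr => p _; case: ifP => _; rewrite (mulr1, mulr0). Qed.

Lemma lin_amp (phi : ket) G :
  lin phi G = \sum_(x <- undup [seq p.1 | p <- phi]) amp phi x * G x.
Proof.
under [RHS]eq_bigr do rewrite mulr_suml.
rewrite exchange_big /=; apply: eq_big_seq => p pphi.
have p1 : p.1 \in undup [seq p.1 | p <- phi] by rewrite mem_undup map_f.
rewrite (bigD1_seq p.1) ?undup_uniq //= asboolT // big1 ?addr0 // => x np.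
by rewrite asboolF ?mul0r // => e; rewrite e eqxx in np.
Qed.

Lemma nrm_lin phi : nrm phi = (lin phi (fun x => (amp phi x)^*))^*.
Proof.
rewrite /nrm /lin rmorph_sum; apply: eq_bigr => p _.
rewrite rmorphM /= conjCK mulr_sumr; apply: eq_bigr => p' _.
have -> : `[< p.1 = p'.1 >] = `[< p'.1 = p.1 >] by apply: asbool_equiv_eq; split=> ->.
by case: ifP; rewrite ?mulr0.
Qed.

Lemma nrm_amp (phi : ket) :
  nrm phi = \sum_(x <- undup [seq p.1 | p <- phi]) `|amp phi x| ^+ 2.
Proof.
rewrite nrm_lin lin_amp rmorph_sum; apply: eq_bigr => x _.
by rewrite normCK rmorphM /= conjCK mulrC.
Qed.

Lemma nrm_ge0 (phi : ket) : 0 <= nrm phi.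
Proof. by rewrite nrm_amp sumr_ge0 // => x _; rewrite exprn_ge0. Qed.

(** Grouping equal basis states turns [nrm] into a sum of squared moduli of amplitudes, so each
    amplitude must vanish. *)
Lemma nrm_eq0 phi : nrm phi = 0 -> null phi.
Proof.
rewrite nrm_amp => /eqP; rewrite psumr_eq0 => [/allP n0 G|x _]; last first.
  by rewrite exprn_ge0.
rewrite lin_amp big_seq big1 // => x /n0; rewrite sqrf_eq0 normr_eq0 => /eqP ->.
by rewrite mul0r.
Qed.

Lemma null_nrm phi : null phi -> nrm phi = 0.
Proof. by move=> n0; rewrite nrm_lin n0 conjC0. Qed.

Definition double_lin (phi : ket) (F : tapes -> tapes -> C) : C :=
  lin phi (fun x => (lin phi (fun y => (F x y)^*))^*).

Lemma double_linE phi (B : tapes -> tapes -> bool) :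
  \sum_(p <- phi) \sum_(p' <- phi)
     (if B p.1 p'.1 then p.2 * (p'.2)^* else 0) =
  double_lin phi (fun x y => (B x y)%:R).
Proof.
apply: eq_bigr => p _; rewrite /lin rmorph_sum mulr_sumr; apply: eq_bigr => p' _.
by rewrite rmorphM /= conjCK; case: (B _ _); rewrite ?mulr1 ?mulr0.
Qed.

End Kets.

(** * Total probability of the branches with a given kind of result *)

Section Weights.
Variables (R : realType) (k : nat) (Q : finType) (qb : Q) (M : cqtm R k Q).
Local Notation C := (R[i]).

(** A predicate instead of a single result makes both [prob] and the distribution pushed forward
    along [map_result] instances. *)
Definition weight (P : pred (result C Q)) t q tau h phi : C :=
  \sum_(b <- exec qb (M := M) t q tau h phi) if P b.2 then b.1 else 0.

Definition stop (p : target (cK M)) (phi : ket R k Q) : result C Q :=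
  match p with
  | TGo _ => RRun | TYes => RYes | TNo => RNo | THalt => RHalt (rho qb phi)
  end.

Definition weight_at P t (p : target (cK M)) tau h phi : C :=
  if p is TGo q then weight P t q tau h phi
  else if P (stop p phi) then nrm phi else 0.

Lemma weight0 P q tau h phi :
  weight P 0 q tau h phi = if P RRun then nrm phi else 0.
Proof. by rewrite /weight big_seq1. Qed.

Lemma weightS P t q tau h phi :
  weight P t.+1 q tau h phi =
  let: (p, D, T) := cdelta q tau in
  \sum_c weight_at P t p c (move h D) (apply_op (T c) (move h D) phi).
Proof.
rewrite /weight /=; case: (cdelta q tau) => [[p D] T].
rewrite big_flatten big_map -big_enum; apply: eq_bigr => c _.
by case: p => [q'| | |] //=; rewrite big_seq1.
Qed.

Lemma weight_null P t q tau h phi : null phi -> weight P t q tau h phi = 0.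
Proof.
elim: t q tau h phi => [|t IH] q tau h phi n0.
  by rewrite weight0 null_nrm // if_same.
rewrite weightS; case: (cdelta q tau) => [[p D] T]; apply: big1 => c _.
have n1 : null (apply_op (T c) (move h D) phi) by apply: apply_op_null.
case: p => [q'| | |] /=; first exact: IH.
all: by rewrite null_nrm // if_same.
Qed.

Lemma weight_at_null P t p tau h phi : null phi -> weight_at P t p tau h phi = 0.
Proof.
by case: p => [q| | |] n0 /=; [exact: weight_null|rewrite null_nrm // if_same..].
Qed.

Lemma weight_ge0 P t q tau h phi : 0 <= weight P t q tau h phi.
Proof.
elim: t q tau h phi => [|t IH] q tau h phi.
  by rewrite weight0; case: ifP => _ //; apply: nrm_ge0.
rewrite weightS; case: (cdelta q tau) => [[p D] T]; apply: sumr_ge0 => c _.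
by case: p => [q'| | |] //=; case: ifP => _ //; apply: nrm_ge0.
Qed.

Lemma weight_at_ge0 P t p tau h phi : 0 <= weight_at P t p tau h phi.
Proof.
by case: p => [q| | |] /=; [exact: weight_ge0|case: ifP => _ //; apply: nrm_ge0..].
Qed.

End Weights.

(** * Injective relabellings of configurations preserve outputs *)

Section Encodings.
Variables (R : realType) (k k' : nat) (Q Q' : finType) (qb : Q) (qb' : Q').
Local Notation C := (R[i]).

(** Push-forward of [phi] along [f] as a vector; how the two formal sums are written does not
    matter. *)
Definition represents (f : tapes k Q -> tapes k' Q') (phi : ket R k Q)
    (phi' : ket R k' Q') : Prop :=
  forall G, lin phi' G = lin phi (G \o f).

Lemma represents_null f phi phi' : represents f phi phi' -> null phi -> null phi'.
Proof. by move=> r n0 G; rewrite r n0. Qed.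

Lemma represents_nrm f phi phi' :
  injective f -> represents f phi phi' -> nrm phi' = nrm phi.
Proof.
move=> finj r; rewrite !nrm_lin r; congr (_^*); apply: eq_lin => x /=.
rewrite !ampE r; congr (_^*); apply: eq_lin => y /=; congr ((nat_of_bool _)%:R).
by apply: asbool_equiv_eq; split=> [/finj|->].
Qed.

Variables (iota : Q -> Q').
Hypotheses (iota_inj : injective iota) (iota_qb : iota qb = qb').

Lemma preim_map s : Defs.preim iota (map iota s) = Some s.
Proof.
elim: s => //= q s ->; case: pickP => [q1 /eqP/iota_inj -> //|/(_ q)].
by rewrite eqxx.
Qed.

Lemma preim_Some s' s : Defs.preim iota s' = Some s -> s' = map iota s.
Proof.
elim: s' s => [|q' s' IH] s /=; first by case=> <-.
case: pickP => [q /eqP <-|//]; case: (Defs.preim iota s') IH => [s1|//] IH.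
by case=> <- /=; rewrite -(IH s1).
Qed.

Variable f : tapes k Q -> tapes k' Q'.
Hypothesis f_tape1 : forall x z, f x ord0 z = iota (x ord0 z).
Hypothesis f_others : forall x y,
  (forall i z, i != ord0 -> f x i z = f y i z) <->
  (forall i z, i != ord0 -> x i z = y i z).

Lemma encoding_inj : injective f.
Proof.
move=> x y e; apply: funext => i; apply: funext => z.
have [->|i0] := eqVneq i ord0; first by apply: iota_inj; rewrite -!f_tape1 e.
by apply: (f_others x y).1 => // j z' _; rewrite e.
Qed.

(** A pair of configurations enters the partial trace in [rho] only if the environments agree. As
    [f] both preserves and reflects agreement of the other tapes, the same pairs enter after
    encoding. *)
Lemma agree_off_encoding b x y : agree_off b (f x) (f y) = agree_off b x y.
Proof.
have split_tapes : forall n (A : finType) (u v : tapes n A),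
    (forall i z, ~ (i = ord0 /\ in_seg b z) -> u i z = v i z) <->
    (forall i z, i != ord0 -> u i z = v i z) /\
    (forall z, ~~ in_seg b z -> u ord0 z = v ord0 z).
  move=> n A u v; split=> [e|[e1 e0] i z nz].
    split=> [i z /eqP i0|z /negP nz]; first by apply: e => -[].
    by apply: e => -[].
  have [i0|/e1 -> //] := eqVneq i ord0; rewrite i0; apply: e0.
  by apply/negP => zb; apply: nz.
apply: asbool_equiv_eq; rewrite !split_tapes f_others.
split=> -[e1 e0]; split=> // z /e0; first by rewrite !f_tape1 => /iota_inj.
by rewrite !f_tape1 => ->.
Qed.

Lemma seg_encoding b x : seg b (f x) = map iota (seg b x).
Proof.
case: b => [[l r]|] //=; rewrite f_tape1; congr (_ :: _).
by rewrite -map_comp; apply: eq_map => j /=; rewrite f_tape1.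
Qed.

Lemma occupied_encoding phi phi' :
  represents f phi phi' -> occupied qb' phi' = occupied qb phi.
Proof.
move=> r; apply: funext => z; apply: propext.
have ampf x : amp phi' (f x) = amp phi x.
  rewrite !ampE r; apply: eq_lin => y /=; congr ((nat_of_bool _)%:R).
  by apply: asbool_equiv_eq; split=> [/encoding_inj|->].
split=> [[x' [ax' x'z]]|[x [ax xz]]].
  have [[x fx]|nfx] := EM (exists x, f x = x').
    exists x; rewrite -ampf fx; split=> //; apply: contraNneq x'z => xz.
    by rewrite -fx f_tape1 xz iota_qb.
  move/eqP: ax'; case; rewrite ampE r /lin; apply: big1 => p _ /=.
  by rewrite asboolF ?mulr0 // => fx; apply: nfx; exists p.1.
exists (f x); rewrite ampf; split=> //; rewrite f_tape1 -iota_qb.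
by apply: contra_neq xz => /iota_inj.
Qed.

Lemma rho_encoding phi phi' : represents f phi phi' ->
  RHalt (rho qb' phi') = map_result iota (RHalt (rho qb phi)).
Proof.
move=> r; congr RHalt; apply: funext => s'; apply: funext => t'.
have bE : seg_bounds qb' phi' = seg_bounds qb phi.
  by rewrite /seg_bounds (occupied_encoding r).
rewrite /rho bE (represents_nrm encoding_inj r); set b := seg_bounds qb phi.
rewrite (double_linE phi' (fun x y =>
  [&& seg b x == s', seg b y == t' & agree_off b x y])).
have dbl F : double_lin phi' F = double_lin phi (fun x y => F (f x) (f y)).
  by rewrite /double_lin r; apply: eq_lin => x /=; rewrite r.
rewrite dbl.
have dbl0 F : (forall x y, F x y = 0) -> double_lin phi F = 0.
  move=> F0; rewrite /double_lin /lin big1 // => p _.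
  by rewrite big1 ?conjC0 ?mulr0 // => p' _; rewrite F0 conjC0 mulr0.
(* A string without preimage is never a segment of an encoded tape, so its matrix entry is 0, which
   is also the default value in [map_result]. *)
have noneF s1 x : Defs.preim iota s1 = None -> (seg b (f x) == s1) = false.
  by move=> p0; apply: contra_eqF p0 => /eqP <-; rewrite seg_encoding preim_map.
case es: (Defs.preim iota s') => [s|]; last first.
  by rewrite dbl0 ?mul0r // => x y; rewrite noneF.
case et: (Defs.preim iota t') => [t|]; last first.
  by rewrite dbl0 ?mul0r // => x y; rewrite (noneF t') // andbF.
rewrite (double_linE phi (fun x y =>
  [&& seg b x == s, seg b y == t & agree_off b x y])).
rewrite (preim_Some es) (preim_Some et); congr (_ / _).
apply: eq_lin => x; congr (_^*); apply: eq_lin => y.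
by rewrite !seg_encoding !(inj_eq (inj_map iota_inj)) agree_off_encoding.
Qed.

End Encodings.

(** * Deterministic transformations with a classical record *)

Section Instruments.
Variables (R : realType) (k : nat) (Q : finType).
Local Notation C := (R[i]).
Local Notation cells := (cells k Q).

(** The operator for outcome [c] is the sum of [|g u><u|] over the [u] with [m u = c]. *)
Definition det_op (SC : finType) (g : cells -> cells) (m : cells -> SC) :
    SC -> op R k Q :=
  fun c w u => ((w == g u) && (m u == c))%:R.

(** In the entry at [u], [v] only the term [c = m u], [w = g u] survives, and it is 1 exactly when
    [g] and [m] both agree on [u] and [v]. Thus [g] may merge states that the outcome tells
    apart. *)
Lemma det_op_admissible (SC : finType) g (m : cells -> SC) :
  injective (fun u => (g u, m u)) -> admissible (det_op g m).
Proof.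
move=> gm_inj u v; rewrite (bigD1 (m u)) //= [X in _ + X]big1; last first.
  move=> c cu; apply: big1 => w _; rewrite /det_op.
  by rewrite [m u == c]eq_sym (negbTE cu) andbF conjC0 mul0r.
rewrite addr0 (bigD1 (g u)) //= big1 => [|w wu]; last first.
  by rewrite /det_op (negbTE wu) conjC0 mul0r.
rewrite addr0 /det_op !eqxx /= conjC1 mul1r.
by rewrite -[u == v](inj_eq gm_inj) xpair_eqE [m u == m v]eq_sym.
Qed.

Lemma blank_test_admissible (qb : Q) (SC : finType) (cb cnb : SC) i :
  cb != cnb -> admissible (@blank_test R k Q qb SC cb cnb i).
Proof.
move=> bnb; have -> : @blank_test R k Q qb SC cb cnb i =
    det_op id (fun u => if u i == qb then cb else cnb).
  apply: funext => c; apply: funext => w; apply: funext => u.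
  rewrite /blank_test /det_op; case: (u i == qb) => /=.
    rewrite [cb == c]eq_sym; case: (c == cb); rewrite ?andbT ?andbF //.
    by case: (c == cnb).
  rewrite andbT andbF [cnb == c]eq_sym; case: eqP => [->|_].
    by rewrite (negbTE bnb) andbF.
  by case: (c == cnb); rewrite ?andbT ?andbF.
by apply: det_op_admissible => u v [].
Qed.

Lemma lin_det_op (SC : finType) g (m : cells -> SC) c h (phi : ket R k Q) G :
  lin (apply_op (det_op g m c) h phi) G =
  lin phi (fun x => if m (read x h) == c
                    then G (write x h (g (read x h))) else 0).
Proof.
rewrite lin_apply_op; apply: eq_lin => x.
rewrite (bigD1 (g (read x h))) //= big1 => [|w nw].
  by rewrite addr0 /det_op eqxx /=; case: ifP; rewrite ?mul1r ?mul0r.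
by rewrite /det_op (negbTE nw) mul0r.
Qed.

End Instruments.

(** * Transformations acting on one tensor factor *)

Section LiftedInstruments.
Variables (R : realType) (k k' : nat) (Q Q' : finType) (SC O : finType).
Local Notation C := (R[i]).
Variables (get : cells k' Q' -> cells k Q).
Variables (put : cells k' Q' -> cells k Q -> cells k' Q').
Hypothesis get_put : forall u w, get (put u w) = w.
Hypothesis put_get : forall u, put u (get u) = u.
Hypothesis put_put : forall u v w, put (put u v) w = put u w.

(* [put]/[get] exhibits the cells as a tensor product; this is T (x) Id. *)
Definition lift_op (T : SC -> op R k Q) : SC + O -> op R k' Q' :=
  fun o w u => if o is inl c
    then if w == put u (get w) then T c (get w) (get u) else 0
    else 0.

Lemma sum_lift_op T c u (G : cells k' Q' -> C) :
  \sum_w lift_op T (inl c) w u * G w = \sum_w T c w (get u) * G (put u w).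
Proof.
rewrite (bigID (fun w => w == put u (get w))) /= addrC big1 ?add0r.
  rewrite (reindex_onto (put u) get) => [|w /eqP <- //].
  apply: eq_big => w; first by rewrite !get_put !eqxx.
  by rewrite /lift_op get_put eqxx.
by move=> w /negbTE nw; rewrite /lift_op nw mul0r.
Qed.

Lemma lift_op_admissible T : admissible T -> admissible (lift_op T).
Proof.
move=> aT u v; rewrite big_sumType /= [X in _ + X]big1 ?addr0; last first.
  by move=> o _; apply: big1 => w _; rewrite mulr0.
(* The test [v == put u (get v)] says that [u] and [v] agree on the untouched factor, which
   contributes the identity. *)
have sumE c : \sum_w (lift_op T (inl c) w u)^* * lift_op T (inl c) w v =
    if v == put u (get v) then \sum_w (T c w (get u))^* * T c w (get v) else 0.
  under eq_bigr do rewrite mulrC.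
  rewrite sum_lift_op; case: eqP => [vu|nvu].
    apply: eq_bigr => w _; rewrite mulrC /lift_op get_put.
    by rewrite [X in put X w]vu put_put eqxx.
  apply: big1 => w _; rewrite /lift_op get_put ifN ?conjC0 ?mulr0 //.
  apply: contra_notN nvu => /eqP e.
  by rewrite -{1}[v]put_get -(put_put v w) e !put_put.
under eq_bigr do rewrite sumE.
case: eqP => [vu|nvu].
  rewrite aT; congr ((nat_of_bool _)%:R).
  apply/eqP/eqP=> [e|-> //].  by rewrite vu -e put_get.
rewrite big1 //; case: eqP => // uv; case: nvu.
by rewrite -uv put_get.
Qed.

End LiftedInstruments.
(** * The two-tape machine *)

Section Cells.
Variables (k : nat) (Q : finType) (qb : Q).

(* A cell holds k.+1 upper and k.+1 lower symbols and a mark. On tape 1 the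
   upper symbol 0 is the cell of the simulated tape 1, the others carry symbols
   along tape 2. Tape 2 is folded at the heads of the simulated tapes: cell j
   holds the symbols at distance j to the right (up) and to the left (down) of
   each head. Marks: [Some true] at the fold, [Some false] on the other cells
   visited so far, [None] elsewhere. *)
Definition fcell : finType :=
  ({ffun 'I_k.+1 -> Q} * {ffun 'I_k.+1 -> Q} * option bool)%type.
Local Notation fcells := (cells 1 fcell).

Definition up (c : fcell) := c.1.1.
Definition dn (c : fcell) := c.1.2.
Definition mark (c : fcell) := c.2.

Definition embed_symbol (q : Q) : fcell :=
  ([ffun l => if l == ord0 then q else qb], [ffun=> qb], None).

Lemma embed_symbol_inj : injective embed_symbol.
Proof. by move=> q q' [] /ffunP /(_ ord0); rewrite !ffunE. Qed.

Definition visit (m : option bool) := if m is None then Some false else m.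

(** An involution instead of the constant [Some true], so that marking the fold permutes the basis
    states. *)
Definition toggle (m : option bool) :=
  match m with None => Some true | Some true => None | _ => m end.

Lemma toggleK : involutive toggle. Proof. by case=> [[]|]. Qed.

(* On the fold only the upper symbols are in use. *)
Definition side (m : option bool) (s : 'I_k.+1 -> option bool) l :=
  if m == Some true then omap (fun=> true) (s l) else s l.

(** For each [l], [s l] selects the symbol on tape 2 that is exchanged with the spare slot [l] on
    tape 1: the upper one for [Some true], the lower one for [Some false], neither for [None]. *)
Definition swap (s : 'I_k.+1 -> option bool) (u : fcells) : fcells :=
  let e := side (mark (u ord_max)) s in
  [ffun j => if j == ord0
    then ([ffun l => match e l with Some true => up (u ord_max) l
                     | Some false => dn (u ord_max) l | None => up (u ord0) l end],
          dn (u ord0), mark (u ord0))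
    else ([ffun l => if e l is Some true then up (u ord0) l else up (u ord_max) l],
          [ffun l => if e l is Some false then up (u ord0) l else dn (u ord_max) l],
          visit (mark (u ord_max)))].

Lemma I2_cases (j : 'I_2) : j = ord0 \/ j = ord_max.
Proof.
by case: j => [[|[|//]] lt_j]; [left|right]; apply: val_inj.
Qed.

(** The old mark decides which slots are exchanged, and [visit] forgets whether it was [None] or
    [Some false]; recording it as outcome makes the swap reversible. *)
Lemma swap_inj s : injective (fun u => (swap s u, mark (u ord_max))).
Proof.
move=> u v [] /ffunP e em.
move: (e ord0) (e ord_max); rewrite !ffunE /= -em.
case=> /ffunP e1 e2 e3; case=> /ffunP e4 /ffunP e5.
apply/ffunP => j; case: (I2_cases j) => -> {j}.
  move: e1 e2 e3 e4 e5; rewrite /up /dn /mark.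
  case: (u ord0) (v ord0) => [[a b] m] [[a' b'] m'] /= e1 -> -> e4 e5.
  congr (_, _, _); apply/ffunP => l; move: (e1 l) (e4 l) (e5 l); rewrite !ffunE.
  by case: (side _ _ _) => [[]|].
move: e1 e4 e5 em; rewrite /up /dn /mark.
case: (u ord_max) (v ord_max) => [[a b] m] [[a' b'] m'] /= e1 e4 e5 em.
congr (_, _, _) => //.
all: apply/ffunP => l; move: (e1 l) (e4 l) (e5 l); rewrite !ffunE.
all: by case: (side _ _ _) => [[]|].
Qed.

Definition mark_fold (u : fcells) : fcells :=
  [ffun j => if j == ord0 then u ord0
             else ((u ord_max).1, toggle (mark (u ord_max)))].

Lemma mark_fold_inj : injective mark_fold.
Proof.
move=> u v /ffunP e; move: (e ord0) (e ord_max); rewrite !ffunE /= => e0.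
case=> e1 /(can_inj toggleK) e3; apply/ffunP => j.
case: (I2_cases j) => -> //; move: e1 e3; rewrite /mark.
by case: (u ord_max) (v ord_max) => [? ?] [? ?] /= -> ->.
Qed.

Definition get (u : fcells) : cells k Q :=
  [ffun l => if l == ord0 then up (u ord0) l else up (u ord_max) l].

Definition put (u : fcells) (w : cells k Q) : fcells :=
  [ffun j => if j == ord0
    then ([ffun l => if l == ord0 then w l else up (u ord0) l],
          dn (u ord0), mark (u ord0))
    else ([ffun l => if l == ord0 then up (u ord_max) l else w l],
          dn (u ord_max), mark (u ord_max))].

Lemma get_put u w : get (put u w) = w.
Proof. by apply/ffunP => l; rewrite !ffunE /=; case: ifP => ->. Qed.

Lemma put_get u : put u (get u) = u.
Proof.
apply/ffunP => j; case: (I2_cases j) => ->; rewrite !ffunE /= /dn /mark.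
  case E: (u ord0) => [[a b] m] /=; congr (_, _, _); apply/ffunP => l.
  by rewrite !ffunE /up E; case: ifP => // ->.
case E: (u ord_max) => [[a b] m] /=; congr (_, _, _); apply/ffunP => l.
by rewrite !ffunE /up E; case: ifP => // ->.
Qed.

Lemma put_put u v w : put (put u v) w = put u w.
Proof.
apply/ffunP => j; case: (I2_cases j) => ->; rewrite !ffunE /=.
all: rewrite /up /dn /mark /=; congr (_, _, _).
all: by apply/ffunP => l; rewrite !ffunE; case: ifP => // ->.
Qed.

(** The common shape of all configurations met in the simulation: [car] is the carry in the spare
    slots of cell [h0] of tape 1, [b] the unfolded content of tape 2, and [V] its last marked cell,
    with [None] before the fold is marked. *)
Definition conf (x0 : int -> Q) (h0 : int) (car : 'I_k.+1 -> Q)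
    (b : 'I_k.+1 -> int -> Q) (V : option nat) : tapes 1 fcell :=
  fun i z => if i == ord0
    then ([ffun l => if l == ord0 then x0 z else if z == h0 then car l else qb],
          [ffun=> qb], None)
    else ([ffun l => if 0 <= z then b l z else qb],
          [ffun l => if 0 < z then b l (- z) else qb],
          if V is Some v then
            if z == 0 then Some true else if (0 < z) && (z <= v%:Z) then Some false
            else None
          else None).

Definition heads2 (a b : int) : heads 1 := fun i => if i == ord0 then a else b.
Definition dirs2 (a b : dir) : 'I_2 -> dir := fun i => if i == ord0 then a else b.

Definition shift1 (d : dir) (z : int) : int :=
  match d with DL => z - 1 | DR => z + 1 | DN => z end.

Lemma move_heads2 a b d e :
  move (heads2 a b) (dirs2 d e) = heads2 (shift1 d a) (shift1 e b).
Proof.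
by apply: funext => i; case: (I2_cases i) => ->; case: d e => [] [].
Qed.

Definition sgn (s : bool) : int := if s then 1 else - 1.

Definition swap_carry (s : 'I_k.+1 -> option bool) (j : int)
    (car : 'I_k.+1 -> Q) (b : 'I_k.+1 -> int -> Q) : 'I_k.+1 -> Q :=
  fun l => if s l is Some r then b l (sgn r * j) else car l.

Definition swap_row (s : 'I_k.+1 -> option bool) (j : int)
    (car : 'I_k.+1 -> Q) (b : 'I_k.+1 -> int -> Q) : 'I_k.+1 -> int -> Q :=
  fun l z => if s l is Some r then if z == sgn r * j then car l else b l z
             else b l z.

Definition mark_at (V : nat) (j : nat) : option bool :=
  if j == 0%N then Some true else if (j <= V)%N then Some false else None.

Lemma mark_conf x0 h0 car b V (j : nat) :
  mark (read (conf x0 h0 car b (Some V)) (heads2 h0 j%:Z) ord_max) = mark_at V j.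
Proof.
rewrite /mark ffunE /conf /heads2 /= /mark_at.
by case: j => [|j] //=.
Qed.

(** Slot 0 holds the content of the simulated tape 1, hence [s ord0 = None]. The bound on [j] keeps
    the marked cells an interval, extended by one when [j = V.+1]. *)
Lemma swap_conf s x0 h0 car b V V' (j : nat) :
  s ord0 = None -> (j <= V.+1)%N -> V' = maxn V j ->
  let x := conf x0 h0 car b (Some V) in let h := heads2 h0 j%:Z in
  write x h (swap s (read x h)) =
  conf x0 h0 (swap_carry s j%:Z car b) (swap_row s j%:Z car b) (Some V').
Proof.
move=> s0 jV -> x h; apply: funext => i; apply: funext => z; rewrite /write.
have markE : mark (read x h ord_max) = mark_at V j by apply: mark_conf.
have sideE l : side (mark_at V j) s l =
    if j == 0%N then omap (fun=> true) (s l) else s l.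
  by rewrite /side /mark_at; case: (j == 0%N) => //; case: (j <= V)%N.
have sl l r : s l = Some r -> l != ord0.
  by move=> El; apply: contra_eqN El => /eqP ->; rewrite s0.
case: (I2_cases i) => ->; rewrite /h /heads2 /=; last first.
  case: eqP => [->|zj].
    rewrite ffunE /= -/h markE /conf /=; congr (_, _, _).
    - apply/ffunP => l; rewrite !ffunE /= sideE /swap_row eqxx.
      case El: (s l) (sl l) => [[]|] /= l0.
      + by rewrite (negbTE (l0 _ erefl)) /= mul1r eqxx; case: (j == 0%N).
      + rewrite (negbTE (l0 _ erefl)); case: eqP => [->|j0]; first by rewrite mulr0 eqxx.
        by rewrite ifF //; lia.
      + by case: (j == 0%N).
    - apply/ffunP => l; rewrite !ffunE /= sideE /swap_row eqxx.
      case El: (s l) (sl l) => [[]|] /= l0.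
      + by case: j {jV markE sideE x h} => [|j] //=; rewrite ifF //; lia.
      + rewrite (negbTE (l0 _ erefl)); case: j {jV markE sideE x h} => [|j] //=.
        by rewrite mulN1r eqxx.
      + by case: (j == 0%N).
    - rewrite /mark_at; case: j jV {markE sideE x h} => [|j] //= jV.
      by case: ifP => jV'; rewrite /= ifT //; lia.
  rewrite /x /conf /=; congr (_, _, _).
  - apply/ffunP => l; rewrite !ffunE /swap_row; case: ifP => // z0.
    case El: (s l) => [[]|] //=; rewrite ifF //; lia.
  - apply/ffunP => l; rewrite !ffunE /swap_row; case: ifP => // z0.
    case El: (s l) => [[]|] //=; rewrite ifF //; lia.
  - case: ifP => // z0; case: ifP => zV; case: ifP => zV' //; lia.
case: eqP => [->|zh]; last first.
  have {}zh : (z == h0) = false by apply/eqP.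
  by rewrite /x /conf /= zh.
rewrite ffunE /= -/h markE /conf /=; congr (_, _, _).
  apply/ffunP => l; rewrite !ffunE /= sideE /swap_carry eqxx.
  case El: (s l) (sl l) => [[]|] /= l0.
  + by rewrite (negbTE (l0 _ erefl)) mul1r; case: (j == 0%N).
  + rewrite (negbTE (l0 _ erefl)); case: j {jV markE sideE x h} => [|j] //=.
    by rewrite mulN1r.
  + by case: (j == 0%N).
  by apply/ffunP => l; rewrite !ffunE.
by rewrite /mark ffunE.
Qed.

(** * Rotating the rows by an outward and an inward sweep *)

Section Sweep.
Variables (s : 'I_k.+1 -> option bool) (a : 'I_k.+1 -> int -> Q).

Let s' l := omap negb (s l).

(* Contents of the carry and of the rows once the outward sweep has passed
   cell j, resp. once the inward sweep has passed cell j. *)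
Definition out_carry (j : int) l :=
  if s l is Some r then a l (sgn r * j) else qb.

Definition out_row (j : int) l (z : int) :=
  if s l is Some r then
    if z == 0 then qb
    else if (0 < sgn r * z) && (sgn r * z <= j) then a l (z - sgn r) else a l z
  else a l z.

Definition in_carry (j : int) l :=
  if s l is Some r then a l (- sgn r * j) else qb.

Definition in_row (j : int) l (z : int) :=
  if s l is Some r then
    if z == 0 then qb
    else if (0 < sgn r * z) || (sgn r * z <= - j) then a l (z - sgn r) else a l z
  else a l z.

Definition shifted l (z : int) :=
  if s l is Some r then a l (z - sgn r) else a l z.

Lemma out_start :
  swap_carry s 0 (fun=> qb) a = out_carry 0 /\
  swap_row s 0 (fun=> qb) a = out_row 0.
Proof.
split; apply: funext => l; last apply: funext => z; rewrite /swap_carry /swap_row.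
  by rewrite /out_carry.
rewrite /out_row; case: (s l) => [r|] //; rewrite mulr0; case: eqP => // z0.
by case: ifP => //; lia.
Qed.

(** On the outgoing side each cell receives the symbol of its neighbour nearer to the fold, and its
    own symbol is carried on. *)
Lemma out_step (j : nat) :
  swap_carry s j.+1%:Z (out_carry j%:Z) (out_row j%:Z) = out_carry j.+1%:Z /\
  swap_row s j.+1%:Z (out_carry j%:Z) (out_row j%:Z) = out_row j.+1%:Z.
Proof.
split; apply: funext => l; last apply: funext => z; rewrite /swap_carry /swap_row.
  rewrite /out_carry /out_row; case: (s l) => [[]|] //=.
    by rewrite !mul1r ifF //; lia.
  by rewrite !mulN1r ifF //; lia.
rewrite /out_carry /out_row; case: (s l) => [[]|] //=.
  rewrite !mul1r; case: eqP => [->|zj]; last first.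
    by case: ifP => // z0; case: ifP => z1; case: ifP => z2 //; lia.
  by rewrite ifT; [congr (a l _)|]; lia.
rewrite !mulN1r; case: eqP => [->|zj]; last first.
  by case: ifP => // z0; case: ifP => z1; case: ifP => z2 //; lia.
by rewrite ifT; [congr (a l _)|]; lia.
Qed.

(** From distance [N] on the moving rows are blank, so a blank is carried around the turn and the
    cyclic rotation coincides with a shift of the infinite rows. *)
Lemma turn_step (N : nat) : (0 < N)%N ->
  (forall l z, s l != None -> N%:Z <= `|z| -> a l z = qb) ->
  swap_carry s' N%:Z (out_carry N%:Z) (out_row N%:Z) = in_carry N%:Z /\
  swap_row s' N%:Z (out_carry N%:Z) (out_row N%:Z) = in_row N%:Z.
Proof.
move=> N0 aN.
split; apply: funext => l; last apply: funext => z; rewrite /swap_carry /swap_row.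
  rewrite /in_carry /out_carry /out_row /s'; case: (s l) => [[]|] //=.
    by rewrite !mulN1r !mul1r ifF; [rewrite ifF //|]; lia.
  by rewrite opprK !mul1r !mulN1r ifF; [rewrite ifF //|]; lia.
rewrite /in_row /out_carry /out_row /s'; case: (s l) (aN l) => [[]|] //= {}aN.
  rewrite !mulN1r !mul1r; case: eqP => [->|zN].
    by rewrite ifF 1?ifT ?aN //; lia.
  case: ifP => // z0; case: ifP => z1; case: ifP => z2 //; first by lia.
  by rewrite !aN //; lia.
rewrite opprK !mulN1r !mul1r; case: eqP => [->|zN].
  by rewrite ifF 1?ifT ?aN //; lia.
case: ifP => // z0; case: ifP => z1; case: ifP => z2 //; first by lia.
by rewrite !aN //; lia.
Qed.

Lemma in_step (j : nat) : (0 < j)%N ->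
  swap_carry s' j%:Z (in_carry j.+1%:Z) (in_row j.+1%:Z) = in_carry j%:Z /\
  swap_row s' j%:Z (in_carry j.+1%:Z) (in_row j.+1%:Z) = in_row j%:Z.
Proof.
move=> j0.
split; apply: funext => l; last apply: funext => z; rewrite /swap_carry /swap_row.
  rewrite /in_carry /in_row /s'; case: (s l) => [[]|] //=.
    by rewrite !mulN1r !mul1r ifF; [rewrite ifF //|]; lia.
  by rewrite opprK !mul1r !mulN1r ifF; [rewrite ifF //|]; lia.
rewrite /in_carry /in_row /s'; case: (s l) => [[]|] //=.
  rewrite !mulN1r !mul1r; case: eqP => [->|zN].
    by rewrite ifF 1?ifT; [congr (a l _)|..]; lia.
  by case: ifP => // z0; case: ifP => z1; case: ifP => z2 //; lia.
rewrite opprK !mulN1r !mul1r; case: eqP => [->|zN].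
  by rewrite ifF 1?ifT; [congr (a l _)|..]; lia.
by case: ifP => // z0; case: ifP => z1; case: ifP => z2 //; lia.
Qed.

(** The blank dropped at the fold by the first swap returns to the carry, so the spare slots are
    clean for the next cycle. *)
Lemma in_stop :
  swap_carry s' 0 (in_carry 1) (in_row 1) = (fun=> qb) /\
  swap_row s' 0 (in_carry 1) (in_row 1) = shifted.
Proof.
split; apply: funext => l; last apply: funext => z; rewrite /swap_carry /swap_row.
  by rewrite /in_carry /in_row /s'; case: (s l) => [[]|] //=; rewrite mulr0.
rewrite /in_carry /in_row /s' /shifted; case: (s l) => [r|] //=.
rewrite mulr0; case: eqP => [->|z0]; first by rewrite mulr1 sub0r.
by rewrite ifT //; case: (r); rewrite /= ?mul1r ?mulN1r; lia.
Qed.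

End Sweep.
End Cells.

(** * Following a single deterministic branch *)

Section DeterministicSteps.
Variables (R : realType) (k k' : nat) (Q Q' : finType) (qb' : Q').
Variable M' : cqtm R k' Q'.

(** During a sweep the simulated ket [phi] stays fixed and only the encoding [f] changes. *)
Definition runs_to (P : pred (result R[i] Q')) t (q : cK M') tau h
    (f : tapes k Q -> tapes k' Q') (phi : ket R k Q) (v : R[i]) : Prop :=
  forall phi', represents f phi phi' -> weight qb' P t q tau h phi' = v.

Lemma runs_to_det (S : tapes k Q -> Prop) P t q tau h f phi v q' D g
    (m : cells k' Q' -> cSC M') c f2 :
  cdelta q tau = (TGo q', D, det_op R g m) -> supported S phi ->
  (forall x, S x -> m (read (f x) (move h D)) = c /\
     write (f x) (move h D) (g (read (f x) (move h D))) = f2 x) ->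
  runs_to P t q' c (move h D) f2 phi v -> runs_to P t.+1 q tau h f phi v.
Proof.
move=> dE Sphi step run phi' r; rewrite weightS dE (bigD1 c) //=.
rewrite big1 ?addr0 => [|c' c'c].
  apply: run => G; rewrite lin_det_op r; apply: Sphi => x Sx /=.
  by have [-> ->] := step x Sx; rewrite eqxx.
apply: weight_null => G; rewrite lin_det_op r.
rewrite (Sphi _ (fun=> 0)) => [|x Sx /=].
  by rewrite /lin big1 // => p _; rewrite mulr0.
by have [-> _] := step x Sx; rewrite eq_sym (negbTE c'c).
Qed.

End DeterministicSteps.

(** * Construction of the machine and correctness of the simulation *)

Section Simulation.
Variables (R : realType) (k : nat) (Q : finType) (qb : Q) (M : cqtm R k Q).
Local Notation C := (R[i]).
Local Notation fcell := (fcell k Q).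
Local Notation embed := (@embed_symbol k Q qb).
Local Notation fblank := (embed qb).

(** Relative to a head moving left the content drifts right, so the outward sweep uses the upper
    half. Index 0 is exempt because the head of tape 1 really moves. *)
Definition sides (D : 'I_k.+1 -> dir) (l : 'I_k.+1) : option bool :=
  if l == ord0 then None
  else match D l with DL => Some true | DR => Some false | DN => None end.

Definition sides_back D l := omap negb (sides D l).

(* [None]: initial state; [Some (inl q)]: about to simulate a transition from
   q; [Some (inr (q, tau, out))]: sweeping outwards ([out = true]) or inwards for
   the transition from q on outcome tau. *)
Definition control : finType := option (cK M + (cK M * cSC M * bool))%type.
Definition outcome : finType := (cSC M + option bool)%type.

Definition swap_op s : outcome -> op R 1 fcell :=
  det_op R (swap s) (fun u => inr (mark (u ord_max)) : outcome).

(** The reported outcome is the simulated [#], the last outcome with which [M] starts. *)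
Definition mark_op : outcome -> op R 1 fcell :=
  det_op R (@mark_fold k Q) (fun=> inl (cb M) : outcome).

Definition lift_target (p : target (cK M)) : target control :=
  match p with
  | TGo q => TGo (Some (inl q) : control)
  | TYes => TYes | TNo => TNo | THalt => THalt
  end.

(* Apart from the initial state, the last clause is never reached. *)
Definition delta2 (st : control) (o : outcome) :
    target control * ('I_2 -> dir) * (outcome -> op R 1 fcell) :=
  match st, o with
  | Some (inl q), inl tau =>
      let D := (cdelta q tau).1.2 in
      (TGo (Some (inr (q, tau, true)) : control),
       dirs2 (D ord0) DN, swap_op (sides D))
  | Some (inr (q, tau, true)), inr (Some _) =>
      (TGo st, dirs2 DN DR, swap_op (sides (cdelta q tau).1.2))
  | Some (inr (q, tau, true)), inr None =>
      (TGo (Some (inr (q, tau, false)) : control),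
       dirs2 DN DN, swap_op (sides_back (cdelta q tau).1.2))
  | Some (inr (q, tau, false)), inr (Some false) =>
      (TGo st, dirs2 DN DL, swap_op (sides_back (cdelta q tau).1.2))
  | Some (inr (q, tau, false)), inr (Some true) =>
      (lift_target (cdelta q tau).1.1, dirs2 DN DN,
       lift_op (@get k Q) (@put k Q) (cdelta q tau).2)
  | _, _ => (TGo (Some (inl (cs M)) : control), dirs2 DN DN, mark_op)
  end.

Definition two_tape : cqtm R 1 fcell :=
  @Cqtm R 1 fcell control None outcome (inl (cb M)) (inl (cnb M))
    ([seq blank_test R fblank (inl (cb M)) (inl (cnb M)) i | i <- enum 'I_2] ++
     [seq (delta2 p.1 p.2).2 | p <- enum {: control * outcome}])
    delta2.

Lemma memT_cat (T : Type) (x : T) s1 s2 :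
  memT x (s1 ++ s2) <-> memT x s1 \/ memT x s2.
Proof. by elim: s1 => [|y s1 IH] /=; [tauto|rewrite IH; tauto]. Qed.

Lemma memT_map (I : eqType) (T : Type) (x : T) (F : I -> T) s :
  memT x (map F s) <-> exists2 i, i \in s & x = F i.
Proof.
elim: s => [|i s IH] /=; first by split=> // -[].
rewrite IH; split=> [[<-|[j js ->]]|[j]].
- by exists i; rewrite ?mem_head.
- by exists j; rewrite // inE js orbT.
- by rewrite inE => /orP[/eqP -> ->|js ->]; [left|right; exists j].
Qed.

Lemma delta2_admissible st o : wf qb M -> admissible (delta2 st o).2.
Proof.
move=> [_ adm _ memA].
have swapA s : admissible (swap_op s).
  by apply: det_op_admissible => u v [eg em]; apply: (@swap_inj k Q s); rewrite eg em.
have markA : admissible mark_op.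
  by apply: det_op_admissible => u v [/mark_fold_inj].
case: st => [[q|[[q tau] [|]]]|] //=; case: o => [c|[[|]|]] //=.
apply: lift_op_admissible; [exact: get_put|exact: put_get|exact: put_put|].
exact/adm/memA.
Qed.

Lemma two_tape_wf : wf qb M -> wf fblank two_tape.
Proof.
move=> wfM; have [bnb _ _ _] := wfM; split=> //= [T|i|q c].
- rewrite memT_cat !memT_map => -[[i _ ->]|[p _ ->]].
    exact: blank_test_admissible.
  exact: delta2_admissible.
- by rewrite memT_cat !memT_map; left; exists i; rewrite ?mem_enum.
- by rewrite memT_cat !memT_map; right; exists (q, c); rewrite ?mem_enum.
Qed.

Definition rows (h : heads k) (x : tapes k Q) (l : 'I_k.+1) (z : int) : Q :=
  if l == ord0 then qb else x l (h l + z).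

Definition encode (h : heads k) (V : option nat) (x : tapes k Q) :
    tapes 1 fcell :=
  conf qb (x ord0) 0 (fun=> qb) (rows h x) V.

(** An empty carry has no position; this lets the head of tape 1 move at the start of a cycle,
    before anything is carried. *)
Lemma conf_blank_carry x0 h0 h1 (b : 'I_k.+1 -> int -> Q) V :
  conf qb x0 h0 (fun=> qb) b V = conf qb x0 h1 (fun=> qb) b V.
Proof.
apply: funext => i; apply: funext => z; rewrite /conf; case: ifP => // _.
congr (_, _, _); apply/ffunP => l; rewrite !ffunE.
by case: ifP => // _; rewrite !if_same.
Qed.

Lemma encode_tape1 h V x z : encode h V x ord0 z = embed (x ord0 z).
Proof.
rewrite /encode /conf /embed_symbol /=; congr (_, _, _); apply/ffunP => l.
by rewrite !ffunE if_same.
Qed.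

Lemma encode_others h V x y :
  (forall i z, i != ord0 -> encode h V x i z = encode h V y i z) <->
  (forall i z, i != ord0 -> x i z = y i z).
Proof.
split=> e i z i0.
  (* Cell [z] of tape [i] is stored at distance [|z - h i|] from the fold, in the upper or lower
     slot according to the sign. *)
  rewrite -[z](subrKC (h i)); set w := z - h i.
  have := e ord_max `|w| isT; rewrite /encode /conf /= => -[/ffunP/(_ i) eu /ffunP/(_ i)].
  move: eu; rewrite !ffunE /rows (negbTE i0).
  case: (ger0P w) => [_ -> //|w0 _].
  by rewrite oppr_gt0 w0 opprK.
case: (I2_cases i) i0 => -> // _; rewrite /encode /conf /=; congr (_, _, _).
  apply/ffunP => l; rewrite !ffunE /rows; case: ifP => // _.
  by case: eqP => // /eqP l0; rewrite e.
apply/ffunP => l; rewrite !ffunE /rows; case: ifP => // _.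
by case: eqP => // /eqP l0; rewrite e.
Qed.

Definition blank_from (N : nat) (h : heads k) (x : tapes k Q) : Prop :=
  forall l z, l != ord0 -> N%:Z <= `|z| -> x l (h l + z) = qb.

(** A move changes relative positions by at most one, and the symbol written lies at relative
    position 0. *)
Lemma blank_from_move N h D x w : (0 < N)%N -> blank_from N h x ->
  blank_from N.+1 (move h D) (write x (move h D) w).
Proof.
move=> N0 bN l z l0 Nz; rewrite /write /move.
have -> : ((match D l with DL => h l - 1 | DR => h l + 1 | DN => h l end) + z ==
           match D l with DL => h l - 1 | DR => h l + 1 | DN => h l end) = false.
  by case: (D l); lia.
case: (D l).
- by rewrite -addrA bN //; lia.
- by rewrite -addrA bN //; lia.
- by rewrite bN //; lia.
Qed.

Lemma shifted_rows h D x : shifted (sides D) (rows h x) = rows (move h D) x.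
Proof.
apply: funext => l; apply: funext => z; rewrite /shifted /sides /rows /move.
by case: eqP => // _; case: (D l) => //=; congr (x l _); lia.
Qed.

Lemma get_encode h V x :
  get (read (encode h V x) (heads2 (h ord0) 0)) = read x h.
Proof.
apply/ffunP => l; rewrite !ffunE /=; case: eqP => [->|/eqP l0] //=.
by rewrite /rows (negbTE l0) addr0.
Qed.

Lemma put_encode h V x w :
  write (encode h V x) (heads2 (h ord0) 0)
    (put (read (encode h V x) (heads2 (h ord0) 0)) w) =
  encode h V (write x h w).
Proof.
apply: funext => i; apply: funext => z; rewrite [LHS]/write.
case: (I2_cases i) => ->; rewrite /encode /conf /heads2 /=.
  case: eqP => [->|/eqP zh].
    rewrite ffunE /=; congr (_, _, _).
    - apply/ffunP => l; rewrite !ffunE /= /write eqxx.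
      by case: eqP => [->|_]; rewrite ?if_same.
    - by rewrite /dn ffunE.
    - by rewrite /mark ffunE.
  congr (_, _, _); apply/ffunP => l; rewrite !ffunE /write.
  by rewrite (negbTE zh).
case: eqP => [->|/eqP z0].
  rewrite ffunE /=; congr (_, _, _).
  - apply/ffunP => l; rewrite !ffunE /= /rows /write.
    by case: ifP => E; rewrite ?E /= ?addr0 ?eqxx.
  - by rewrite /dn ffunE.
  - by rewrite /mark ffunE.
have nz l : (h l + z == h l) = false by lia.
have nNz l : (h l - z == h l) = false by lia.
by congr (_, _, _); apply/ffunP => l; rewrite !ffunE /rows /write ?nz ?nNz.
Qed.

Lemma represents_lift h V (T : cSC M -> op R k Q) c phi phi' :
  represents (encode h V) phi phi' ->
  represents (encode h V) (apply_op (T c) h phi)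
    (apply_op (lift_op (O := option bool) (@get k Q) (@put k Q) T (inl c))
       (heads2 (h ord0) 0) phi').
Proof.
move=> r G; rewrite !lin_apply_op r; apply: eq_lin => x /=.
rewrite (sum_lift_op (option bool) (@get_put k Q)) get_encode.
by apply: eq_bigr => w _; rewrite put_encode.
Qed.

(** * The two sweeps simulating one move of the heads *)

Section Cycle.
Variables (P : pred (result C fcell)) (h : heads k) (V : nat).
Variables (phi : ket R k Q) (q : cK M) (tau : cSC M).
Hypothesis phi_blank : supported (blank_from V.+1 h) phi.

Let D := (cdelta q tau).1.2.
Let h' := move h D.
Let runs := runs_to (k := k) (Q := Q) (M' := two_tape) fblank P.

Let out_conf (j : nat) (W : nat) (x : tapes k Q) :=
  conf qb (x ord0) (h' ord0) (out_carry qb (sides D) (rows h x) j%:Z)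
    (out_row qb (sides D) (rows h x) j%:Z) (Some W).

Let in_conf (j : nat) (x : tapes k Q) :=
  conf qb (x ord0) (h' ord0) (in_carry qb (sides D) (rows h x) j%:Z)
    (in_row qb (sides D) (rows h x) j%:Z) (Some V.+1).

Let sweep (out : bool) : control := Some (inr (q, tau, out)).

(** The phases are composed from the end: each lemma extends a run starting at its final
    configuration to one starting at its initial configuration. Meeting the mark of the fold ends
    this phase. *)
Lemma inward t v j : (j <= V)%N ->
  runs t (sweep false) (inr (Some true)) (heads2 (h' ord0) 0)
    (encode h' (Some V.+1)) phi v ->
  runs (j.+1 + t) (sweep false) (inr (Some false)) (heads2 (h' ord0) j.+1%:Z)
    (in_conf j.+1) phi v.
Proof.
rewrite /runs; elim: j => [|j IH] jV run; rewrite addSn.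
  apply: (runs_to_det (M' := two_tape) (c := inr (Some true))
    (f2 := encode h' (Some V.+1)) _ phi_blank);
    first by [].
    move=> x _; rewrite move_heads2 /= mark_conf; split=> //.
    rewrite (swap_conf _ _ _ _ (V' := V.+1) _ (j := 0)) //.
    have [-> ->] := in_stop qb (sides D) (rows h x).
    by rewrite shifted_rows; apply: conf_blank_carry.
  by rewrite move_heads2.
apply: (runs_to_det (M' := two_tape) (c := inr (Some false))
  (f2 := in_conf j.+1) _ phi_blank);
  first by [].
  move=> x _; rewrite move_heads2 /= (_ : j.+2%:Z - 1 = j.+1%:Z); last by lia.
  rewrite mark_conf /mark_at ltnW //=; split=> //.
  rewrite (swap_conf _ _ _ _ (V' := V.+1) _ (j := j.+1)) //; [|lia..].
  by have [-> ->] := in_step qb (sides D) (rows h x) (ltn0Sn j).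
rewrite move_heads2 /= (_ : j.+2%:Z - 1 = j.+1%:Z); last by lia.
by apply: IH => //; apply: ltnW.
Qed.

Lemma turn t v :
  runs t (sweep false) (inr (Some true)) (heads2 (h' ord0) 0)
    (encode h' (Some V.+1)) phi v ->
  runs (V.+2 + t) (sweep true) (inr None) (heads2 (h' ord0) V.+1%:Z)
    (out_conf V.+1 V.+1) phi v.
Proof.
move=> run; rewrite /runs addSn.
apply: (runs_to_det (M' := two_tape) (c := inr (Some false))
  (f2 := in_conf V.+1) _ phi_blank);
  first by [].
  move=> x xblank; rewrite move_heads2 /= mark_conf /mark_at leqnn; split=> //.
  rewrite (swap_conf _ _ _ _ (V' := V.+1) _ (j := V.+1)) //; [|lia..].
  have rows_blank l z : sides D l != None -> V.+1%:Z <= `|z| -> rows h x l z = qb.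
    by move=> _ Vz; rewrite /rows; case: eqP => // /eqP l0; apply: xblank.
  by have [-> ->] := turn_step (ltn0Sn V) rows_blank.
by rewrite move_heads2; apply: inward.
Qed.

Lemma outward t v j : (j <= V)%N ->
  runs t (sweep true) (inr None) (heads2 (h' ord0) V.+1%:Z)
    (out_conf V.+1 V.+1) phi v ->
  runs ((V - j).+1 + t) (sweep true) (inr (mark_at V j)) (heads2 (h' ord0) j%:Z)
    (out_conf j V) phi v.
Proof.
move=> jV; have [d] := ubnP (V - j); elim: d j jV => // d IH j jV Vjd run.
have markj : mark_at V j = Some (j == 0%N) by rewrite /mark_at jV; case: eqP.
have step x W : W = maxn V j.+1 ->
    write (out_conf j V x) (heads2 (h' ord0) j.+1%:Z)
      (swap (sides D) (read (out_conf j V x) (heads2 (h' ord0) j.+1%:Z))) =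
    out_conf j.+1 W x.
  move=> EW; rewrite (swap_conf _ _ _ _ (V' := W) _ (j := j.+1)) //.
  by have [-> ->] := out_step qb (sides D) (rows h x) j.
rewrite markj /runs addSn; have [jV'|Vj] := ltnP j V.
  apply: (runs_to_det (M' := two_tape) (c := inr (Some false))
    (f2 := out_conf j.+1 V) _ phi_blank);
    first by [].
    move=> x _; rewrite move_heads2 /= (_ : j%:Z + 1 = j.+1%:Z); last by lia.
    by rewrite mark_conf /mark_at jV' (step x V) //; lia.
  rewrite move_heads2 /= (_ : j%:Z + 1 = j.+1%:Z); last by lia.
  rewrite -subSS subSn //; have := IH j.+1 jV' _ run.
  by rewrite /mark_at jV'; apply; lia.
(* Last outward step: cell [V.+1] is still unmarked, and the outcome [None] triggers the turn. *)
have Ej : j = V by apply/eqP; rewrite eqn_leq jV.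
rewrite (_ : V - j = 0)%N ?add0n; last by lia.
apply: (runs_to_det (M' := two_tape) (c := inr None)
  (f2 := out_conf j.+1 j.+1) _ phi_blank);
  first by [].
  move=> x _; rewrite move_heads2 /= (_ : j%:Z + 1 = j.+1%:Z); last by lia.
  by rewrite mark_conf /mark_at ltnNge Vj (step x j.+1) //; lia.
by rewrite move_heads2 /= (_ : j%:Z + 1 = j.+1%:Z) ?Ej //; lia.
Qed.

Lemma cycle t v :
  runs t (sweep false) (inr (Some true)) (heads2 (h' ord0) 0)
    (encode h' (Some V.+1)) phi v ->
  runs (2 * V + 4 + t) (Some (inl q) : control) (inl tau) (heads2 (h ord0) 0)
    (encode h (Some V)) phi v.
Proof.
move=> run; have -> : (2 * V + 4 + t = ((V - 0).+1 + (V.+2 + t)).+1)%N by lia.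
have hE : move (heads2 (h ord0) 0) (dirs2 (D ord0) DN) = heads2 (h' ord0) 0.
  by rewrite move_heads2 /h' /move; case: (D ord0).
apply: (runs_to_det (M' := two_tape) (c := inr (mark_at V 0))
  (f2 := out_conf 0 V) _ phi_blank);
  first by [].
  move=> x _; rewrite hE /encode (conf_blank_carry _ 0 (h' ord0)) mark_conf.
  split=> //; rewrite (swap_conf _ _ _ _ (V' := V) _ (j := 0)) ?maxn0 //.
  by have [-> ->] := out_start qb (sides D) (rows h x).
by rewrite hE; apply: outward => //; apply: turn.
Qed.

End Cycle.

(* One cycle consists of the swap at the fold, V+1 further outward steps, the turn,
   V+1 inward steps and the simulated transformation. *)
Fixpoint cost (V t : nat) : nat :=
  if t is t'.+1 then 2 * V + 5 + cost V.+1 t' else 0.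

(** The costs of successive cycles form an arithmetic progression with difference 2; the [t] on the
    left avoids truncated subtraction. *)
Lemma cost_le V t : (cost V t + t <= t * (2 * V + 5) + t * t)%N.
Proof. by elim: t V => // t IH V /=; have := IH V.+1; nia. Qed.

Definition running : pred (result C Q) := fun r => `[< r = RRun >].

(** By time [t0] no weight of [M] is left running, so the weights are stationary from then on and
    any [t] and [t'] past the respective bounds can be compared. The induction on [t0] spends one
    cycle per transition. *)
Lemma simulation (P : pred (result C fcell)) t0 t t' V q tau h phi :
  (t0 <= t)%N -> (cost V t0 <= t')%N ->
  supported (blank_from V.+1 h) phi ->
  weight qb running t0 (q : cK M) tau h phi = 0 ->
  runs_to (M' := two_tape) fblank P t' (Some (inl q) : control) (inl tau)
    (heads2 (h ord0) 0) (encode h (Some V)) phi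
    (weight qb (fun r => P (map_result embed r)) t q tau h phi).
Proof.
elim: t0 t t' V q tau h phi => [|t0 IH] t t' V q tau h phi.
  (* At time 0 the running weight is the whole squared norm, so the ket is null. *)
  move=> _ _ _; rewrite weight0 /running asboolT // => /nrm_eq0 n0 phi' r.
  by rewrite !weight_null //; apply: represents_null r n0.
case: t => // t t0t /= costt' phi_blank.
(* The sweeps take [2 * V + 4] steps; the successor is the step applying the simulated
   transformation. *)
have -> : t' = (2 * V + 4 + (t' - (2 * V + 5)).+1)%N by lia.
rewrite !weightS; case dE: (cdelta q tau) => [[p D] T] stopped.
set h' := move h D in stopped *.
apply: cycle => //; rewrite dE /= -/h' => phi' r.
rewrite weightS /= dE /= big_sumType /= [X in _ + X]big1 ?addr0; last first.
  move=> o _; apply: weight_at_null => G; rewrite lin_apply_op.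
  by rewrite /lin big1 // => x _; rewrite big1 ?mulr0 // => w _; rewrite mul0r.
apply: eq_bigr => c _; rewrite move_heads2 /=.
have stopped_c : weight_at qb running t0 p c h' (apply_op (T c) h' phi) = 0.
  apply: (psumr_eq0P _ stopped) => // i _; exact: weight_at_ge0.
have rc := represents_lift T c r; set psi' := apply_op _ _ phi' in rc *.
have inj := encoding_inj (@embed_symbol_inj k Q qb)
              (encode_tape1 h' (Some V.+1)) (encode_others h' (Some V.+1)).
case: p stopped_c {dE stopped} => [q'| | |] /= stopped_c.
- apply: (IH _ _ V.+1) stopped_c _ rc => //; first by lia.
  by apply: apply_op_supported phi_blank => x w; apply: blank_from_move.
- by rewrite (represents_nrm inj rc).
- by rewrite (represents_nrm inj rc).
- have /= <- := rho_encoding (@embed_symbol_inj k Q qb) (erefl fblank)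
                  (encode_tape1 _ _) (encode_others _ _) rc.
  by rewrite (represents_nrm inj rc).
Qed.

Lemma encode_init w :
  init_tapes fblank (map embed w) =
  encode (fun=> 0) None (init_tapes qb w) :> tapes 1 fcell.
Proof.
apply: funext => i; apply: funext => z.
case: (I2_cases i) => ->; rewrite /init_tapes /encode /conf /= ?size_map.
  case: ifP => zw.
    rewrite (nth_map qb) /embed_symbol; last by lia.
    by congr (_, _, _); apply/ffunP => l; rewrite !ffunE if_same.
  by rewrite /embed_symbol; congr (_, _, _); apply/ffunP => l; rewrite !ffunE !if_same.
rewrite /embed_symbol; congr (_, _, _); apply/ffunP => l.
  by rewrite !ffunE /rows /=; case: eqP => //= _; rewrite !if_same.
by rewrite !ffunE /rows /=; case: eqP => //= _; rewrite !if_same.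
Qed.

Lemma represents_init (psi : input R Q) :
  represents (encode (fun=> 0) None) (input_ket k qb psi)
    (input_ket 1 fblank (map_input embed psi)).
Proof.
move=> G; rewrite /lin !big_map; apply: eq_bigr => p _ /=.
by rewrite encode_init.
Qed.

Lemma mark_fold_encode x :
  let u := read (encode (fun=> 0) None x) (heads2 0 0) in
  write (encode (fun=> 0) None x) (heads2 0 0) (mark_fold u) =
  encode (fun=> 0) (Some 0) x.
Proof.
move=> u; apply: funext => i; apply: funext => z; rewrite [LHS]/write.
case: (I2_cases i) => ->; rewrite /heads2 /=.
  by case: eqP => [->|//]; rewrite !ffunE.
case: eqP => [->|/eqP z0]; first by rewrite !ffunE.
rewrite /encode /conf /= (negbTE z0); case: ifP => // z1; lia.
Qed.

Lemma two_tape_run (P : pred (result C fcell)) t0 t t' psi :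
  (t0 <= t)%N -> (6 * t0 ^ 2 <= t')%N ->
  prob qb M t0 psi RRun = 0 ->
  weight fblank P t' (cs two_tape) (cb two_tape) (fun=> 0)
    (input_ket 1 fblank (map_input embed psi)) =
  weight qb (fun r => P (map_result embed r)) t (cs M) (cb M) (fun=> 0)
    (input_ket k qb psi).
Proof.
move=> t0t t0t' stopped; have r := represents_init psi.
have init_blank N : supported (blank_from N (fun=> 0)) (input_ket k qb psi).
  move=> G G' eG; rewrite /lin !big_map; apply: eq_bigr => p _ /=; congr (_ * _).
  by apply: eG => l z l0 _; rewrite /init_tapes (negbTE l0).
(* For [t0 = 0] the bound grants no step even for marking the fold, but then the input ket is
   null. *)
have [t00|t0_gt0] := posnP t0.
  have n0 : null (input_ket k qb psi).
    by apply: nrm_eq0; move: stopped; rewrite t00 /prob big_seq1 /= asboolT.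
  by rewrite !weight_null //; apply: represents_null r n0.
case: t' t0t' => [|t'] t0t'; first by move: t0t'; nia.
have h0 : (fun=> 0) = heads2 0 0 :> heads 1.
  by apply: funext => i; case: (I2_cases i) => ->.
rewrite h0; move: r; apply: (runs_to_det (M' := two_tape) (c := inl (cb M))
  (f2 := encode (fun=> 0) (Some 0%N)) _ (init_blank 0%N)); first by [].
  by move=> x _; rewrite move_heads2 /= mark_fold_encode.
rewrite move_heads2 /=; apply: simulation t0t _ (init_blank _) stopped.
(* With the marking step the total is at most [1 + 4 * t0 + t0 ^ 2], which is at most [6 * t0 ^ 2]
   as [t0 >= 1]. *)
by have := cost_le 0 t0; nia.
Qed.

End Simulation.

Theorem theorem2 (R : realType) (k : nat) (Hk : (1 <= k)%N)
    (Q : finType) (qb : Q) (M : CQTM R k Q) (f : nat -> nat) :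
  wf qb M -> time_bound qb M f ->
  exists (Q' : finType) (qb' : Q') (iota : Q -> Q') (M' : CQTM R 2 Q'),
    [/\ injective iota, iota qb = qb', wf qb' M',
        (exists c N : nat, forall n : nat, (N <= n)%N ->
           forall psi : input R Q, valid_input qb n psi ->
             prob qb' M' (c * f n ^ 2) (map_input iota psi) RRun = 0) &
        (forall (n : nat) (psi : input R Q), valid_input qb n psi ->
           same_output iota qb qb' M M' psi)].
Proof.
move=> wfM timeM.
exists (fcell k.-1 Q), (embed_symbol k.-1 qb qb), (embed_symbol k.-1 qb), (two_tape qb M).
split=> //; first exact: embed_symbol_inj.
- exact: two_tape_wf.
- exists 6%N, 0%N => n _ psi vpsi; have stopped := timeM n psi vpsi.
  have := two_tape_run (fun r => `[< r = RRun >]) (leqnn (f n)) (leqnn _) stopped.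
  rewrite /prob /run /weight => ->; rewrite -[RHS]stopped.
  apply: eq_bigr => -[a [| |rh|]] _ /=.
  1-3: by rewrite !asboolF.
  by rewrite !asboolT.
- move=> n psi vpsi; exists (6 * f n ^ 2)%N => t le_t r'.
  have fnt : (f n <= t)%N by apply: leq_trans le_t; nia.
  exact: (two_tape_run (fun r => `[< r = r' >]) fnt le_t (timeM n psi vpsi)).
Qed.
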